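(* For $k\ge1$ let $t_n^k(213)$ be the number of permutations $\pi\in\mathcal{S}_n$ such that $\pi,\theta(\pi),\theta^2(\pi),\dots,\theta^k(\pi)$ all avoid $213$. Then for $n\geq 5$: $t_n^3(213)=2n+1$, $t_n^4(213)=n+4$, and $t_n^k(213)=7$ for every $k\geq 5$.
   Context: $\mathcal{S}_n$ is the symmetric group on $[n]$, permutations in one-line notation $\pi_1\cdots\pi_n$. A permutation avoids a pattern $\tau$ if it has no subsequence order-isomorphic to $\tau$. The standard cycle notation of $\pi$ writes each cycle (fixed points included) with its largest element first and orders cycles by increasing largest element. The fundamental bijection $\theta:\mathcal{S}_n\to\mathcal{S}_n$ maps $\pi$ to the permutation whose one-line notation is obtained by erasing the parentheses of the standard cycle notation of $\pi$; $\theta^k$ denotes its $k$-fold composition. *)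

(* Defs.v *)
From mathcomp Require Import all_boot fingroup perm.

Set Implicit Arguments.
Unset Strict Implicit.
Unset Printing Implicit Defensive.

(* Permutations of [n] are elements of 'S_n, i.e. they act on {0, .., n-1}
   rather than {1, .., n}. *)

Definition one_line (n : nat) (s : 'S_n) : seq 'I_n :=
  [seq s i | i <- enum 'I_n].

Definition order_iso (u v : seq nat) : bool :=
  (size u == size v) &&
  all (fun i => all (fun j =>
         (nth 0 u i < nth 0 u j) == (nth 0 v i < nth 0 v j))
       (iota 0 (size u))) (iota 0 (size u)).

(* The subsequences of the word of s are its images under bit masks. *)
Definition contains (tau : seq nat) (n : nat) (s : 'S_n) : bool :=
  [exists m : n.-tuple bool,
     order_iso (mask m (map (@nat_of_ord n) (one_line s))) tau].

Definition avoids (tau : seq nat) (n : nat) (s : 'S_n) : bool :=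
  ~~ contains tau s.

(* enum 'I_n is increasing, so cycle maxima come in increasing order. *)
Definition cycle_maxima (n : nat) (s : 'S_n) : seq 'I_n :=
  [seq m : 'I_n <- enum 'I_n | all (fun j : 'I_n => j <= m) (fingraph.orbit s m)].

(* fingraph.orbit s m is the list [:: m; s m; s (s m); ...] of the cycle of m. *)
Definition std_cycles (n : nat) (s : 'S_n) : seq (seq 'I_n) :=
  [seq fingraph.orbit s m | m <- cycle_maxima s].

Definition theta_word (n : nat) (s : 'S_n) : seq 'I_n := flatten (std_cycles s).

Lemma mem_theta_word (n : nat) (s : 'S_n) (x : 'I_n) : x \in theta_word s.
Proof.
have xx : fconnect s x x by exact: connect0.
pose m := [arg max_(j > x | fconnect s x j) (j : nat)].
have [xm maxm] : fconnect s x m /\ forall j, fconnect s x j -> j <= m.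
  by rewrite /m; case: arg_maxnP.
apply/flattenP; exists (fingraph.orbit s m).
  apply: map_f; rewrite mem_filter mem_enum andbT; apply/allP=> j.
  by rewrite -fconnect_orbit => mj; apply: maxm; apply: connect_trans mj.
by rewrite -fconnect_orbit fconnect_sym //; exact: perm_inj.
Qed.

Lemma theta_word_uniq (n : nat) (s : 'S_n) : uniq (theta_word s).
Proof.
have sI : injective s by exact: perm_inj.
have : uniq (cycle_maxima s) by rewrite filter_uniq // enum_uniq.
have : all [pred m : 'I_n | all (fun j : 'I_n => j <= m) (fingraph.orbit s m)]
         (cycle_maxima s) by exact: filter_all.
rewrite /theta_word /std_cycles; elim: (cycle_maxima s) => //= m r IHr.
case/andP=> maxm maxr /andP[mr ur].
rewrite cat_uniq orbit_uniq IHr // andbT; apply/hasPn=> x /flattenP[c].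
case/mapP=> m' m'r ->{c} m'x; apply/negP=> mx.
have mm' : fconnect s m m'.
  rewrite -fconnect_orbit in m'x; rewrite /= -fconnect_orbit in mx.
  by apply: connect_trans mx _; rewrite fconnect_sym.
have le1 : m' <= m by apply: (allP maxm); rewrite -fconnect_orbit.
have le2 : m <= m'.
  have /= /allP := allP maxr _ m'r; apply.
  by rewrite -fconnect_orbit fconnect_sym.
suff E : m = m' by rewrite E m'r in mr.
by apply/val_inj/eqP; rewrite eqn_leq le1 le2.
Qed.

Lemma size_theta_word (n : nat) (s : 'S_n) : size (theta_word s) = n.
Proof.
rewrite -(card_uniqP (theta_word_uniq s)) -[RHS](card_ord n).
by apply: eq_card => x; rewrite mem_theta_word.
Qed.

(* The default value i of nth is never used, by size_theta_word. *)
Definition theta_fun (n : nat) (s : 'S_n) (i : 'I_n) : 'I_n :=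
  nth i (theta_word s) i.

Lemma theta_fun_inj (n : nat) (s : 'S_n) : injective (theta_fun s).
Proof.
move=> i j; rewrite /theta_fun (set_nth_default j i) ?size_theta_word //.
move/eqP; rewrite nth_uniq ?size_theta_word ?theta_word_uniq //.
by move/eqP/val_inj.
Qed.

Definition theta (n : nat) (s : 'S_n) : 'S_n := perm (@theta_fun_inj n s).

Lemma one_line_theta (n : nat) (s : 'S_n) : one_line (theta s) = theta_word s.
Proof.
case: n s => [|n] s.
  by rewrite [LHS]size0nil ?[RHS]size0nil // ?size_theta_word // size_map
    size_enum_ord.
apply: (@eq_from_nth _ ord0).
  by rewrite size_map size_enum_ord size_theta_word.
move=> i; rewrite size_map size_enum_ord => lt_i.
rewrite (nth_map ord0) ?size_enum_ord // permE /theta_fun nth_enum_ord //.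
by apply: set_nth_default; rewrite size_theta_word.
Qed.

Definition t_count (tau : seq nat) (k n : nat) : nat :=
  #|[set s : 'S_n | [forall j : 'I_k.+1, avoids tau (iter j (@theta n) s)]]|.

(* Main.v *)
(** Write N = n - 1 and let c be the cyclic shift i -> i + 1 mod n.
    A permutation fixing 0 is a lift of one of size n - 1, and lifting commutes
    with theta and preserves avoidance of 213; hence it suffices to count, for
    n >= 5, the chains s, theta s, ..., theta^k s avoiding 213 with s 0 <> 0,
    and to settle n = 4 by computation.

    If theta s avoids 213, then s has at most one nontrivial cycle, it contains
    N, and the word of theta s is the increasing list of the fixed points of s
    below N followed by N, s N, s (s N), ... . In particular, if theta s starts
    with N, then s is a full cycle and equals c ^ theta s, the conjugate of c
    by theta s. Comparing the patterns forced in s, theta s, theta^2 s and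
    theta^3 s shows that s 0 <> 0 leaves only the transposition e = (0 N) and
    its preimage c ^ e under theta. The orbit is
      c ^ e -> e -> c -> c^-1 -> reversal,
    and the next word contains 213 because the reversal has several nontrivial
    cycles. *)

Require Import Defs.
From mathcomp Require Import all_boot fingroup perm zify.

Set Implicit Arguments.
Unset Strict Implicit.
Unset Printing Implicit Defensive.

Local Notation p213 := [:: 2; 1; 3].

Lemma map_traject (T U : Type) (f : T -> T) (g : U -> U) (h : T -> U) (x : T)
    (n : nat) :
  (forall y, h (f y) = g (h y)) -> map h (traject f x n) = traject g (h x) n.
Proof. by move=> hfg; elim: n x => //= n IHn x; rewrite IHn hfg. Qed.

Lemma order_size_undup (T : finType) (f : T -> T) (x : T) (n : nat) :
  #|T| <= n -> fingraph.order f x = size (undup (traject f x n)).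
Proof.
move=> Tn; rewrite -(card_uniqP (undup_uniq _)); apply: eq_card => y.
rewrite mem_undup; apply/idP/trajectP => [xy|[i _ ->]];
  last exact: fconnect_iter.
exists (findex f x y); last by rewrite iter_findex.
exact: leq_trans (findex_max xy) (leq_trans (max_card _) Tn).
Qed.

Lemma map_orbit (T U : finType) (f : T -> T) (g : U -> U) (h : T -> U) (x : T) :
  injective h -> (forall y, h (f y) = g (h y)) ->
  map h (fingraph.orbit f x) = fingraph.orbit g (h x).
Proof.
move=> h_inj hfg; rewrite /fingraph.orbit (map_traject _ _ hfg).
congr traject; rewrite (order_size_undup f x (leq_maxl _ #|U|)).
rewrite (order_size_undup g (h x) (leq_maxr #|T| _)).
by rewrite -(map_traject _ _ hfg) undup_map_inj // size_map.
Qed.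

Lemma orbit_fixed (T : finType) (f : T -> T) (x : T) :
  f x = x -> fingraph.orbit f x = [:: x].
Proof.
move=> fx; have loop : fcycle f [:: x] by rewrite /= fx eqxx.
by rewrite -(undup_cycle_cons loop).
Qed.

Lemma perm_inj_eq (T : finType) (s : {perm T}) (x y : T) :
  (s x == s y) = (x == y).
Proof. by rewrite inj_eq //; apply: perm_inj. Qed.

Lemma perm_fclosed (T : finType) (s : {perm T}) (a : {pred T}) :
  (forall x, x \in a -> s x \in a) -> fclosed s a.
Proof.
move=> sa; apply: (intro_closed (fconnect_sym (@perm_inj _ s))) => x _ /eqP <-.
exact: sa.
Qed.

Lemma subseq_flatten (T : eqType) (r1 r2 : seq (seq T)) :
  subseq r1 r2 -> subseq (flatten r1) (flatten r2).
Proof.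
elim: r2 r1 => [|u r2 IHr] [|v r1] //=; first by rewrite sub0seq.
case: eqP => [->|_] /IHr sub; first exact: cat_subseq.
exact: subseq_trans sub (suffix_subseq _ _).
Qed.

Lemma ltn_sorted_enum_ord (n : nat) : sorted (relpre val ltn) (enum 'I_n).
Proof. by rewrite -(sorted_map (f := val)) val_enum_ord iota_ltn_sorted. Qed.

Lemma subseq_enum_ord (n : nat) (r : seq 'I_n) :
  subseq r (enum 'I_n) = sorted (relpre val ltn) r.
Proof.
have ltn_val_trans : transitive (relpre (val : 'I_n -> nat) ltn).
  by move=> y x z /=; apply: ltn_trans.
apply/idP/idP => [sub|r_sorted].
  exact: subseq_sorted sub (ltn_sorted_enum_ord n).
apply/(subseq_uniqP (enum_uniq _)).
apply: (irr_sorted_eq ltn_val_trans) => //.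
- by move=> x /=; rewrite ltnn.
- exact: sorted_filter (ltn_sorted_enum_ord n).
- by move=> x; rewrite mem_filter mem_enum andbT.
Qed.

Lemma gtn_ord0 (n : nat) (i : 'I_n.+1) : (0 < i) = (i != ord0).
Proof. by rewrite lt0n. Qed.

Lemma ltn_ord_max (n : nat) (i : 'I_n.+1) : (i < n) = (i != ord_max).
Proof. by rewrite ltn_neqAle leq_ord andbT. Qed.

Lemma ltn_neq_ord_max (n : nat) (i j : 'I_n.+1) : i < j -> i != ord_max.
Proof. by move=> ij; rewrite -ltn_ord_max (leq_trans ij) ?leq_ord. Qed.

Section Positions.

Variable n : nat.
Implicit Types (s t : 'S_n) (i j k x y z : 'I_n) (r : seq 'I_n).

Definition pos t x : nat := (t^-1)%g x.

Lemma pos_perm t i : pos t (t i) = i.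
Proof. by rewrite /pos permK. Qed.

Lemma pos_eq t i x : pos t x = i -> t i = x.
Proof. by move/val_inj <-; rewrite permKV. Qed.

Lemma pos_inj t : injective (pos t).
Proof. by move=> x y /val_inj/perm_inj. Qed.

Lemma pos_neq t x y : x != y -> pos t x != pos t y.
Proof. by rewrite (inj_eq (@pos_inj t)). Qed.

Lemma ltn_pos t x : pos t x < n.
Proof. exact: ltn_ord. Qed.

Lemma pos_theta s x : pos (theta s) x = index x (theta_word s).
Proof.
rewrite /pos -[in RHS](permKV (theta s) x) [X in index X]permE /theta_fun.
by rewrite index_uniq ?size_theta_word ?theta_word_uniq.
Qed.

Lemma one_line_inj : injective (@one_line n).
Proof.
move=> s t /eq_in_map st; apply/permP => i.
by apply: st; rewrite mem_enum.
Qed.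

Lemma subseq_one_line t r :
  subseq r (one_line t) = sorted ltn [seq pos t x | x <- r].
Proof.
rewrite -[map _ r]/(map (val \o (t^-1)%g) r) map_comp sorted_map.
rewrite -subseq_enum_ord.
apply/idP/idP => [/(map_subseq (t^-1)%g)|/(map_subseq t)].
- by rewrite (mapK (permK t)).
- by rewrite (mapK (permKV t)).
Qed.

Lemma pos_mono_eq s t :
  (forall i j, i < j -> pos s (t i) < pos s (t j)) -> s = t.
Proof.
move=> mono; apply/esym/one_line_inj.
have sub : subseq (one_line t) (one_line s).
  rewrite subseq_one_line sorted_map /one_line sorted_map.
  apply: sub_sorted (ltn_sorted_enum_ord n); exact: mono.
by apply/eqP; rewrite -(size_subseq_leqif sub) !size_map.
Qed.

Lemma containsP tau t :
  reflect (exists2 r, subseq r (one_line t)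
             & order_iso [seq nat_of_ord x | x <- r] tau)
          (contains tau t).
Proof.
apply: (iffP existsP) => [[m iso]|[r /subseqP[m size_m ->] iso]].
  by exists (mask m (one_line t)); rewrite ?mask_subseq // map_mask.
have {}size_m : size m == n by rewrite size_m size_map size_enum_ord.
by exists (Tuple size_m); rewrite -map_mask.
Qed.

Lemma order_iso213 (a b c : nat) : order_iso [:: a; b; c] p213 = (b < a < c).
Proof. by rewrite /order_iso /=; lia. Qed.

Lemma avoids213_posP t :
  reflect (forall x y z, pos t x < pos t y -> pos t y < pos t z ->
             y < x -> z <= x)
          (avoids p213 t).
Proof.
apply: (iffP negP) => [av x y z xy yz yx|av].
  rewrite leqNgt; apply/negP => xz; apply: av; apply/containsP.
  exists [:: x; y; z]; first by rewrite subseq_one_line /= xy yz.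
  by rewrite order_iso213 yx.
case/containsP=> r; rewrite subseq_one_line.
case: r => [|x [|y [|z [|? ?]]]] //= /and3P[xy yz _].
by rewrite order_iso213 => /andP[yx]; rewrite ltnNge (av x y z).
Qed.

Lemma avoids213P t :
  reflect (forall i j k, i < j -> j < k -> t j < t i -> t k <= t i)
          (avoids p213 t).
Proof.
apply: (iffP (avoids213_posP t)) => [av i j k ij jk|av x y z xy yz].
  by apply: av; rewrite !pos_perm.
by have := av _ _ _ xy yz; rewrite !permKV.
Qed.

End Positions.

Section Iterates.

Variables (tau : seq nat) (n : nat).
Implicit Types s : 'S_n.

Definition avoids_iterates k s : bool :=
  all (@avoids tau n) (traject (@theta n) s k.+1).

Lemma t_countE k : t_count tau k n = #|[set s : 'S_n | avoids_iterates k s]|.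
Proof.
apply: eq_card => s; rewrite !inE; apply/forallP/allP => [av t|av j].
  by case/trajectP=> i i_le ->; apply: (av (Ordinal i_le)).
by apply: av; apply/trajectP; exists j.
Qed.

Lemma avoids_iterates_leq k l s :
  k <= l -> avoids_iterates l s -> avoids_iterates k s.
Proof.
rewrite -ltnS /avoids_iterates => /subnKC <-.
by rewrite trajectD all_cat => /andP[].
Qed.

Lemma avoids_iterates_stable k l s :
  (forall t : 'S_n, avoids_iterates k t -> avoids_iterates k.+1 t) ->
  k <= l -> avoids_iterates l s = avoids_iterates k s.
Proof.
move=> stable kl; apply/idP/idP; first exact: avoids_iterates_leq.
rewrite -(subnKC kl); elim: (l - k) s => [|d IHd] s s_k; first by rewrite addn0.
have /andP[av /IHd theta_kd] := stable _ s_k.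
by rewrite addnS; apply/andP.
Qed.

End Iterates.

(** * Permutations with at most one nontrivial cycle *)

Lemma mem_cycle_maxima (n : nat) (s : 'S_n) (x : 'I_n) :
  (x \in cycle_maxima s) = all (fun j : 'I_n => j <= x) (fingraph.orbit s x).
Proof. by rewrite mem_filter mem_enum andbT. Qed.

Section OneCycle.

Variable N : nat.
Implicit Types (s : 'S_N.+1) (x y : 'I_N.+1).

Definition one_cycle s := forall x, s x != x -> fconnect s ord_max x.

Lemma ord_max_in_cycle_maxima s : ord_max \in cycle_maxima s.
Proof. by rewrite mem_cycle_maxima; apply/allP => j _; apply: leq_ord. Qed.

Lemma subseq_theta_word_max s x :
  x \in cycle_maxima s -> x != ord_max -> s x != x ->
  subseq [:: x; s x; ord_max] (theta_word s).
Proof.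
move=> xM xN sx; have xN_maxima : subseq [:: x; ord_max] (cycle_maxima s).
  have := ord_max_in_cycle_maxima s; rewrite mem_cycle_maxima => max_ok.
  rewrite subseq_filter subseq_enum_ord /= max_ok -mem_cycle_maxima xM.
  by rewrite andbT ltn_neqAle xN leq_ord.
apply: subseq_trans (subseq_flatten (map_subseq _ xN_maxima)).
rewrite /= cats0 -[[:: x; s x; ord_max]]/([:: x; s x] ++ [:: ord_max]).
apply: cat_subseq; last by rewrite sub1seq in_orbit.
have : s x \in fingraph.orbit s x by rewrite -fconnect_orbit fconnect1.
rewrite /fingraph.orbit -orderSpred /= inE (negPf sx) /= eqxx.
by rewrite -sub1seq.
Qed.

(* The maximum m <> N of another nontrivial cycle would give the pattern
   m, s m, N in theta s. *)
Lemma avoids213_theta_one_cycle s : avoids p213 (theta s) -> one_cycle s.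
Proof.
move=> av x sx; apply/negPn/negP => Nx.
have /flatten_mapP[m mM] := mem_theta_word s x.
rewrite -fconnect_orbit => mx.
have mN : m != ord_max by apply: contraNneq Nx => <-.
have sm : s m != m.
  apply: contraNneq sx => sm; move: mx.
  by rewrite fconnect_orbit orbit_fixed // inE => /eqP ->; rewrite sm.
have sm_lt : s m < m.
  rewrite ltn_neqAle val_eqE sm; move: mM.
  by rewrite mem_cycle_maxima => /allP; apply;
    rewrite -fconnect_orbit fconnect1.
have := subseq_theta_word_max mM mN sm.
rewrite -one_line_theta subseq_one_line /= => /and3P[pos_m_sm pos_sm_max _].
have := avoids213_posP _ av _ _ _ pos_m_sm pos_sm_max sm_lt.
by rewrite leqNgt ltn_ord_max mN.
Qed.

Definition fixed_below_max s : seq 'I_N.+1 :=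
  [seq i <- enum 'I_N.+1 | (s i == i) && (i != ord_max)].

Lemma mem_fixed_below_max s x :
  (x \in fixed_below_max s) = (s x == x) && (x != ord_max).
Proof. by rewrite mem_filter mem_enum andbT. Qed.

Section ThetaOneCycle.

Variable s : 'S_N.+1.
Hypothesis s_cycle : one_cycle s.

Lemma cycle_maxima_one_cycle :
  cycle_maxima s = rcons (fixed_below_max s) ord_max.
Proof.
have := ord_max_in_cycle_maxima s; rewrite mem_cycle_maxima => max_ok.
rewrite /cycle_maxima /fixed_below_max enum_ordSr !filter_rcons max_ok.
rewrite eqxx andbF; congr rcons; apply: eq_in_filter => x /mapP[j _ ->{x}].
set x := widen_ord _ _; have xN : x < N := ltn_ord j.
have -> : x != ord_max by rewrite -val_eqE /= neq_ltn xN.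
rewrite andbT; case: eqVneq => [sx|sx]; first by rewrite orbit_fixed //= leqnn.
apply/negbTE/allPn; exists ord_max; last by rewrite -ltnNge.
by rewrite -fconnect_orbit (fconnect_sym (@perm_inj _ s)) s_cycle.
Qed.

Lemma theta_word_one_cycle :
  theta_word s = fixed_below_max s ++ fingraph.orbit s ord_max.
Proof.
rewrite /theta_word /std_cycles cycle_maxima_one_cycle map_rcons flatten_rcons.
rewrite (_ : map _ _ = [seq [:: x] | x <- fixed_below_max s]); last first.
  apply/eq_in_map => x; rewrite mem_fixed_below_max => /andP[/eqP sx _].
  exact: orbit_fixed.
by rewrite (flatten_map1 id) map_id.
Qed.

Lemma pos_theta_fixed x :
  s x = x -> x != ord_max -> pos (theta s) x = index x (fixed_below_max s).
Proof.
move=> sx xN; rewrite pos_theta theta_word_one_cycle index_cat.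
by rewrite mem_fixed_below_max sx eqxx xN.
Qed.

Lemma pos_theta_cycle x : fconnect s ord_max x ->
  pos (theta s) x = size (fixed_below_max s) + findex s ord_max x.
Proof.
move=> Nx; rewrite pos_theta theta_word_one_cycle index_cat ifN //.
rewrite mem_fixed_below_max; apply/negP => /andP[/eqP sx xN].
move: Nx; rewrite (fconnect_sym (@perm_inj _ s)) fconnect_orbit orbit_fixed //.
by rewrite inE eq_sym (negPf xN).
Qed.

Lemma pos_theta_max_le x :
  fconnect s ord_max x -> pos (theta s) ord_max <= pos (theta s) x.
Proof. by move=> Nx; rewrite !pos_theta_cycle // leq_add2l findex0. Qed.

Lemma pos_theta_fixed_lt_cycle x y :
  s x = x -> x != ord_max -> fconnect s ord_max y ->
  pos (theta s) x < pos (theta s) y.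
Proof.
move=> sx xN Ny; rewrite pos_theta_fixed // pos_theta_cycle //; apply: ltn_addr.
by rewrite index_mem mem_fixed_below_max sx eqxx.
Qed.

Lemma pos_theta_fixed_mono x y :
  s x = x -> s y = y -> y != ord_max -> x < y ->
  pos (theta s) x < pos (theta s) y.
Proof.
move=> sx sy yN xy.
have xN := ltn_neq_ord_max xy.
have : subseq [:: x; y] (theta_word s).
  rewrite theta_word_one_cycle; apply: subseq_trans (prefix_subseq _ _).
  by rewrite subseq_filter subseq_enum_ord /= sx sy xN yN !eqxx xy.
by rewrite -one_line_theta subseq_one_line /= andbT.
Qed.

Lemma pos_theta_succ x : fconnect s ord_max x -> s x != ord_max ->
  pos (theta s) (s x) = (pos (theta s) x).+1.
Proof.
move=> Nx sxN; have Nsx := connect_trans Nx (fconnect1 _ _).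
rewrite !pos_theta_cycle // -addnS; congr (_ + _).
have := findex_max Nx; have := iter_findex Nx.
move: (findex _ _ x) => i xE i_lt.
have : i.+1 < fingraph.order s ord_max.
  rewrite ltn_neqAle i_lt andbT; apply: contraNneq sxN => i_last.
  by rewrite -xE -iterS i_last iter_order //; apply: perm_inj.
by move=> lt_order; rewrite -xE -iterS findex_iter.
Qed.

Lemma perm_theta_last : s (theta s ord_max) = ord_max.
Proof.
have -> : theta s ord_max = last ord_max (theta_word s).
  by rewrite -nth_last size_theta_word permE.
rewrite theta_word_one_cycle last_cat /fingraph.orbit -orderSpred /=.
by rewrite last_traject -iterS orderSpred iter_order //; apply: perm_inj.
Qed.

Lemma theta_first_fixed :
  theta s ord0 != ord_max -> s (theta s ord0) = theta s ord0.
Proof.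
move=> t0N; apply/eqP/negPn/negP => /s_cycle/pos_theta_max_le.
rewrite pos_perm leqn0 => /eqP pos_max.
by rewrite -(@pos_eq _ (theta s) ord0 ord_max) ?eqxx in t0N.
Qed.

End ThetaOneCycle.

End OneCycle.

Section FullCycle.

Variable N : nat.
Implicit Types (s t : 'S_N.+1) (i j x y : 'I_N.+1).

Definition cshift : 'S_N.+1 := perm (@ordS_inj N.+1).

Lemma val_cshift x : cshift x = (if x < N then x.+1 else 0) :> nat.
Proof.
rewrite permE /=; case: ltnP => xN; first by rewrite modn_small.
by rewrite (_ : x = N :> nat) ?modnn //; apply/eqP; rewrite eqn_leq leq_ord.
Qed.

Lemma cshift_max : cshift ord_max = ord0.
Proof. by apply: val_inj; rewrite /= val_cshift ltnn. Qed.

Lemma cshift_conjg_theta s :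
  one_cycle s -> theta s ord0 = ord_max -> (cshift ^ theta s)%g = s.
Proof.
move=> s_cycle t0; apply/permP => x; rewrite -[x](permKV (theta s)) permJ.
move: (_ x) => i; have [->|iN] := eqVneq i ord_max.
  by rewrite perm_theta_last // cshift_max.
have max_i : fconnect s ord_max (theta s i).
  have [->|tiN] := eqVneq (theta s i) ord_max; first exact: connect0.
  apply: (s_cycle); apply/eqP => si.
  have := pos_theta_fixed_lt_cycle s_cycle si tiN (connect0 _ _).
  by rewrite -t0 !pos_perm.
have siN : s (theta s i) != ord_max.
  by rewrite -(perm_theta_last s_cycle) !perm_inj_eq.
apply/pos_eq; rewrite pos_theta_succ // pos_perm val_cshift.
by rewrite ltn_ord_max iN.
Qed.

Lemma theta_cshift_conjg t : t ord0 = ord_max -> theta (cshift ^ t)%g = t.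
Proof.
move=> t0; set s := (cshift ^ t)%g.
have s_succ i j : j = i.+1 :> nat -> s (t i) = t j.
  move=> ij; rewrite permJ; congr (t _); apply: val_inj.
  by rewrite /= val_cshift ij (_ : i < N) // -ltnS -ij.
have max_t m (m_lt : m < N.+1) : fconnect s ord_max (t (Ordinal m_lt)).
  elim: m m_lt => [|m IHm] m_lt.
    by rewrite (_ : Ordinal m_lt = ord0) ?t0 ?connect0 //; apply: val_inj.
  rewrite -(s_succ (Ordinal (ltnW m_lt))) //.
  exact: connect_trans (IHm _) (fconnect1 _ _).
have max_all x : fconnect s ord_max x.
  by rewrite -[x](permKV t); case: (_ x) => m m_lt; apply: max_t.
have s_cycle : one_cycle s by [].
apply: pos_mono_eq => i j ij.
have posE m (m_lt : m < N.+1) :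
    pos (theta s) (t (Ordinal m_lt)) = pos (theta s) ord_max + m.
  elim: m m_lt => [|m IHm] m_lt.
    by rewrite addn0 -t0; congr (pos _ (t _)); apply: val_inj.
  have s_pred := s_succ (Ordinal (ltnW m_lt)) (Ordinal m_lt) erefl.
  rewrite -s_pred pos_theta_succ // ?IHm ?addnS // s_pred -t0.
  by rewrite perm_inj_eq -val_eqE.
by case: i j ij => [i i_lt] [j j_lt]; rewrite !posE ltn_add2l.
Qed.

End FullCycle.

(** * Classification of the chains moving 0 *)

Section Classification.

Variable N : nat.
Implicit Types (s t : 'S_N.+1) (f x y : 'I_N.+1).

Definition swap : 'S_N.+1 := tperm ord0 ord_max.
Definition preswap : 'S_N.+1 := (cshift N ^ swap)%g.

Lemma val_swap x :
  swap x = (if x == 0 :> nat then N else if x == N :> nat then 0 else x) :> nat.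
Proof.
case: tpermP => [->|->|/eqP x0 /eqP xN] //=; first by rewrite eqxx; case: eqP.
rewrite -[x == ord0]val_eqE in x0; rewrite -[x == ord_max]val_eqE in xN.
by rewrite (negPf x0) (negPf xN).
Qed.

Lemma val_preswap x : 2 < N ->
  preswap x = (if x == 0 :> nat then N else if x == N :> nat then 1
               else if x == N.-1 :> nat then 0 else x.+1) :> nat.
Proof.
move=> N_gt2.
rewrite /preswap conjgE !permM tpermV val_swap val_cshift val_swap.
by have := leq_ord x; do ![case: ifP]; lia.
Qed.

Lemma one_cycle_eq_swap s :
  one_cycle s -> s ord0 = ord_max -> s ord_max = ord0 -> s = swap.
Proof.
move=> s_cycle s0 sN.
have closed_pair : fclosed s (mem [:: ord0; ord_max]).
  apply: perm_fclosed => x.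
  by rewrite !inE => /orP[] /eqP ->; rewrite ?s0 ?sN eqxx ?orbT.
apply/permP => x; case: tpermP => [->|->|/eqP x0 /eqP xN] //.
apply/eqP/negPn/negP => /s_cycle/(closed_connect closed_pair).
by rewrite !inE eqxx orbT (negPf x0) (negPf xN).
Qed.

(* Otherwise s N, 0, s 0 occur in this order in theta s, and s N < s 0 because
   s avoids the pattern s 0, 0, s N. *)
Lemma avoids213_image_max_eq0 s :
  avoids_iterates p213 1 s -> s ord0 != ord0 -> s ord0 != ord_max ->
  s ord_max = ord0.
Proof.
case/and3P=> av av1 _ s00 s0N; have s_cycle := avoids213_theta_one_cycle av1.
have N0 : fconnect s ord_max ord0 := s_cycle _ s00.
have max0 : ord_max != ord0 :> 'I_N.+1.
  by move: s00 s0N; rewrite -!val_eqE /=; have := ltn_ord (s ord0); lia.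
apply/eqP/negPn/negP => sN0.
have sNN : s ord_max != ord_max.
  apply: contra_neq max0 => sNN; move: N0.
  by rewrite fconnect_orbit orbit_fixed // inE => /eqP.
have sN_lt : s ord_max < s ord0.
  have sN_le : s ord_max <= s ord0.
    apply: (avoids213_posP _ av _ ord0); rewrite ?pos_perm.
    - by move: (pos_neq s s00); rewrite pos_perm /=; lia.
    - by move: (pos_neq s sN0) (ltn_pos s ord0); rewrite pos_perm /=; lia.
    - by rewrite gtn_ord0.
  by rewrite ltn_neqAle sN_le andbT val_eqE perm_inj_eq.
suff : s ord0 <= s ord_max by rewrite leqNgt sN_lt.
apply: (avoids213_posP _ av1 _ ord0).
- move: (pos_neq (theta s) max0) (pos_neq (theta s) sN0).
  rewrite (pos_theta_succ s_cycle (connect0 _ _) sNN).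
  by have := pos_theta_max_le s_cycle N0; lia.
- by rewrite pos_theta_succ.
- by rewrite gtn_ord0.
Qed.

Lemma avoids213_theta_first_max s :
  avoids_iterates p213 2 s -> s ord0 != ord0 -> s ord0 != ord_max ->
  theta s ord0 = ord_max.
Proof.
case/andP=> _ av_theta s00 s0N; case/andP: (av_theta) => av1 _.
have s_cycle := avoids213_theta_one_cycle av1.
apply/eqP/negPn/negP => t0N; have st0 := theta_first_fixed s_cycle t0N.
have t00 : theta s ord0 != ord0.
  by apply: contraNneq s00 => t00; rewrite -{1}t00 st0 t00.
have tN := avoids213_image_max_eq0 av_theta t00 t0N.
by have := perm_theta_last s_cycle; rewrite tN => s0; rewrite s0 eqxx in s0N.
Qed.

(* If f <= s N, then s would map [f + 1, N] into itself, while s 0 = N. *)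
Lemma avoids213_image_max_lt_fixed s f :
  avoids p213 s -> s ord0 = ord_max -> s f = f -> f != ord_max ->
  s ord_max < f.
Proof.
move=> av s0 sf fN; rewrite ltnNge; apply/negP => f_le.
have f_lt : f < s ord_max.
  by rewrite ltn_neqAle f_le andbT val_eqE -{1}sf perm_inj_eq.
have closed_above : fclosed s [pred x : 'I_N.+1 | f < x].
  apply: perm_fclosed => x; rewrite !inE => fx.
  have [->//|xN] := eqVneq x ord_max.
  have sxf : s x != f by rewrite -{1}sf perm_inj_eq -val_eqE gtn_eqF.
  rewrite ltnNge; apply: contraL f_lt => sx_le; rewrite -leqNgt -[in _ <= f]sf.
  apply: (avoids213P _ av f x); rewrite ?ltn_ord_max ?sf //.
  by rewrite ltn_neqAle val_eqE sxf.
by have := fclosed1 closed_above ord0; rewrite !inE s0 /= ltn_ord_max fN.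
Qed.

(* Otherwise f, s N, x occur in this order in theta s. *)
Lemma avoids213_theta_fixed_above s f x :
  avoids p213 (theta s) -> s f = f -> s ord_max < f -> f < x -> x != ord_max ->
  s x = x.
Proof.
move=> av sf sN_lt fx xN; have s_cycle := avoids213_theta_one_cycle av.
have [fN sNN] := (ltn_neq_ord_max fx, ltn_neq_ord_max sN_lt).
have xsN : x != s ord_max by rewrite -val_eqE gtn_eqF // (ltn_trans sN_lt).
apply/eqP/negPn/negP => /s_cycle max_x; move: fx; apply/negP; rewrite -leqNgt.
have pos_sN := pos_theta_succ s_cycle (connect0 _ _) sNN.
apply: (avoids213_posP _ av f (s ord_max)) => //.
  by rewrite pos_sN leqW // pos_theta_fixed_lt_cycle ?connect0.
move: (pos_neq (theta s) xN) (pos_neq (theta s) xsN).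
by have := pos_theta_max_le s_cycle max_x; rewrite pos_sN; lia.
Qed.

Lemma theta_second_fixed s :
  one_cycle s -> theta s ord0 != ord_max ->
  (forall x, theta s ord0 < x -> x != ord_max -> s x = x) ->
  theta s (inord 1) = (theta s ord0).+1 :> nat.
Proof.
set f := theta s ord0 => s_cycle fN fixed_above.
have f_lt : f < N by rewrite ltn_ord_max.
have val1 : (inord 1 : 'I_N.+1) = 1 :> nat by rewrite inordK //; lia.
pose g : 'I_N.+1 := inord f.+1; have gE : g = f.+1 :> nat by rewrite inordK.
set x := theta s (inord 1).
have pos_x : pos (theta s) x = 1 by rewrite pos_perm.
have pos_f : pos (theta s) f = 0 by rewrite pos_perm.
have sf : s f = f := theta_first_fixed s_cycle fN.
have [-> //|xg] := eqVneq x g.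
have pos_xg : pos (theta s) x < pos (theta s) g.
  have fg : f != g by rewrite -val_eqE /= gE ltn_eqF.
  move: (pos_neq (theta s) xg) (pos_neq (theta s) fg).
  by rewrite pos_f pos_x; lia.
have x_not_cycle : ~~ fconnect s ord_max x.
  apply/negP => max_x; have [gN|gN] := eqVneq g ord_max.
    by move: (pos_theta_max_le s_cycle max_x) pos_xg; rewrite gN; lia.
  have sg : s g = g by apply: fixed_above => //; rewrite gE.
  by move: (pos_theta_fixed_lt_cycle s_cycle sg gN max_x) pos_xg; lia.
have sx : s x = x.
  by apply/eqP/negPn; apply: contraNN x_not_cycle; apply: s_cycle.
have xN : x != ord_max by apply: contraNneq x_not_cycle => ->; apply: connect0.
have fx : f < x.
  have fx : f != x by rewrite perm_inj_eq -val_eqE /= val1.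
  rewrite ltn_neqAle val_eqE fx leqNgt /=; apply/negP => xf.
  by have := pos_theta_fixed_mono s_cycle sx sf fN xf; rewrite pos_f.
have gx : g < x by rewrite ltn_neqAle eq_sym val_eqE xg gE.
have gN := ltn_neq_ord_max gx.
have sg : s g = g by apply: fixed_above; rewrite // gE.
by move: (pos_theta_fixed_mono s_cycle sg sx xN gx) pos_xg; lia.
Qed.

Section FirstMax.

Variable s : 'S_N.+1.

Let t := theta s.
Let f := t ord0.
Let o1 : 'I_N.+1 := inord 1.

Hypotheses (s0 : s ord0 = ord_max) (sN0 : s ord_max != ord0).
Hypotheses (av_s : avoids p213 s) (av_t : avoids p213 t).
Hypothesis av_theta_t : avoids p213 (theta t).
Hypothesis fN : f != ord_max.

Let s_cycle : one_cycle s := avoids213_theta_one_cycle av_t.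
Let t_cycle : one_cycle t := avoids213_theta_one_cycle av_theta_t.

Let sf : s f = f := theta_first_fixed s_cycle fN.

Let sN_lt : s ord_max < f := avoids213_image_max_lt_fixed av_s s0 sf fN.

Let f_gt1 : 1 < f.
Proof. by move: sN0 sN_lt; rewrite -gtn_ord0; lia. Qed.

Let f_ltN : f < N.
Proof. by rewrite ltn_ord_max. Qed.

Let val_o1 : o1 = 1 :> nat.
Proof. by rewrite inordK //; lia. Qed.

Let tN : t ord_max = ord0.
Proof. by apply: (@perm_inj _ s); rewrite perm_theta_last. Qed.

Let pos_theta_0 : pos (theta t) ord0 = (pos (theta t) ord_max).+1.
Proof.
rewrite -{1}tN pos_theta_succ ?connect0 // tN -ltn_ord_max /=.
exact: leq_ltn_trans f_ltN.
Qed.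

Let pos_theta_f : pos (theta t) f = (pos (theta t) ord_max).+2.
Proof. by rewrite /f pos_theta_succ // ?pos_theta_0 // -tN fconnect1. Qed.

Let t1 : t o1 = f.+1 :> nat.
Proof.
apply: theta_second_fixed => // x fx xN.
exact: (avoids213_theta_fixed_above av_t sf).
Qed.

(* Otherwise f, 1, f + 1 occur in this order in theta (theta s). *)
Lemma first_fixed_penultimate : f = N.-1 :> nat.
Proof.
have [//|f_pen] := eqVneq (f : nat) N.-1.
have t1N : t o1 != ord_max.
  by rewrite -ltn_ord_max t1; move: f_pen fN; rewrite -ltn_ord_max; lia.
have max1 : fconnect t ord_max o1.
  by apply: t_cycle; rewrite -val_eqE /= t1 val_o1; lia.
suff : t o1 <= f by rewrite t1 ltnn.
apply: (avoids213_posP _ av_theta_t f o1); last by rewrite val_o1.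
- have o1N : o1 != ord_max by rewrite -ltn_ord_max val_o1; lia.
  have o10 : o1 != ord0 by rewrite -gtn_ord0 val_o1.
  have o1f : o1 != f by rewrite -val_eqE /= val_o1 ltn_eqF.
  move: (pos_neq (theta t) o1N) (pos_neq (theta t) o10) (pos_neq (theta t) o1f).
  have := pos_theta_max_le t_cycle max1.
  by rewrite pos_theta_f pos_theta_0; lia.
- by rewrite pos_theta_succ.
Qed.

(* Otherwise s 1, 0, f occur in this order in s. *)
Lemma image1_eq0 : s o1 = ord0.
Proof.
have [//|s1_neq0] := eqVneq (s o1) ord0.
have s1f : s o1 != f by rewrite -sf perm_inj_eq -val_eqE /= val_o1 ltn_eqF.
have s1N : s o1 != ord_max.
  by rewrite -s0 perm_inj_eq -val_eqE /= val_o1.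
have : f <= s o1.
  apply: (avoids213_posP _ av_s _ ord0); last by rewrite gtn_ord0.
  - have s00 : s ord0 != ord0 by rewrite s0 -gtn_ord0 /=; lia.
    move: (pos_neq s s1_neq0) (pos_neq s s00).
    by rewrite !pos_perm val_o1 /=; lia.
  - have f0 : f != ord0 by rewrite -gtn_ord0 ltnW.
    have pos_f : pos s f = f by rewrite -{1}sf pos_perm.
    move: (pos_neq s sN0) (pos_neq s f0) (ltn_pos s ord0).
    by have := first_fixed_penultimate; rewrite pos_perm pos_f /=; lia.
move: s1f s1N; rewrite -ltn_ord_max -val_eqE /=.
by have := first_fixed_penultimate; lia.
Qed.

Lemma theta_fclosed_cycle4 : fclosed t (mem [:: ord_max; ord0; f; o1]).
Proof.
have tf : t f = o1.
  apply: pos_eq; rewrite first_fixed_penultimate; apply/eqP; rewrite -eqSS.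
  have max1 : fconnect s ord_max o1.
    by apply: s_cycle; rewrite image1_eq0 -val_eqE /= val_o1.
  have <- := pos_theta_succ s_cycle max1; last first.
    by rewrite image1_eq0 -val_eqE /=; lia.
  by rewrite image1_eq0 -tN pos_perm; apply/eqP => /=; lia.
have t1_max : t o1 = ord_max.
  by apply: val_inj; rewrite /= t1 first_fixed_penultimate; lia.
apply: perm_fclosed => x.
by rewrite !inE => /or4P[] /eqP->; rewrite ?tN ?tf ?t1_max eqxx ?orbT.
Qed.

(* 2 is fixed by theta s, so that 2, 0, N - 1 occur in this order in
   theta (theta s). *)
Lemma avoids213_first_max_leq3 : N <= 3.
Proof.
rewrite leqNgt; apply/negP => N_gt3.
pose o2 : 'I_N.+1 := inord 2.
have val_o2 : o2 = 2 :> nat by rewrite inordK //; lia.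
have t2 : t o2 = o2.
  apply/eqP/negPn/negP => /t_cycle/(closed_connect theta_fclosed_cycle4).
  by rewrite !inE eqxx -!val_eqE /= val_o1 val_o2 first_fixed_penultimate; lia.
have : f <= o2.
  apply: (avoids213_posP _ av_theta_t o2 ord0).
  - apply: (pos_theta_fixed_lt_cycle t_cycle t2); last by rewrite -tN fconnect1.
    by rewrite -ltn_ord_max val_o2 ltnW.
  - by rewrite pos_theta_f pos_theta_0.
  - by rewrite val_o2.
by rewrite val_o2 first_fixed_penultimate; lia.
Qed.

End FirstMax.

Lemma avoids213_first_max_cases s :
  3 < N -> avoids_iterates p213 2 s -> s ord0 = ord_max ->
  theta s ord0 = ord_max \/ s ord_max = ord0.
Proof.
move=> N_gt3 av s0; have [|t0N] := eqVneq (theta s ord0) ord_max; first by left.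
have [|sN0] := eqVneq (s ord_max) ord0; first by right.
case/and4P: av => av0 av1 av2 _.
have := avoids213_first_max_leq3 s0 sN0 av0 av1 av2 t0N.
by rewrite leqNgt N_gt3.
Qed.

Lemma avoids213_first_max_mem s :
  3 < N -> avoids_iterates p213 2 s -> s ord0 = ord_max ->
  s \in [:: swap; preswap].
Proof.
move=> N_gt3 av s0; case/and4P: (av) => _ av1 av2 _.
have s_cycle := avoids213_theta_one_cycle av1.
rewrite !inE.
case: (avoids213_first_max_cases N_gt3 av s0) => [t0|sN]; last first.
  by rewrite (one_cycle_eq_swap s_cycle) ?eqxx.
have tN : theta s ord_max = ord0.
  by apply: (@perm_inj _ s); rewrite perm_theta_last.
have theta_s_swap := one_cycle_eq_swap (avoids213_theta_one_cycle av2) t0 tN.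
by rewrite -(cshift_conjg_theta s_cycle t0) theta_s_swap eqxx orbT.
Qed.

(* If 0 < s 0 < N, then theta s would start with N, 0, which is the case neither
   for swap nor for preswap. *)
Lemma avoids213_moving0_mem s :
  3 < N -> avoids_iterates p213 3 s -> s ord0 != ord0 ->
  s \in [:: swap; preswap].
Proof.
move=> N_gt3 av s00; have av2 := avoids_iterates_leq (leqnSn 2) av.
have [s0|s0N] := eqVneq (s ord0) ord_max.
  exact: avoids213_first_max_mem.
case/andP: (av) => _ av_theta.
case/andP: (av_theta) => /avoids213_theta_one_cycle s_cycle _.
have t0 := avoids213_theta_first_max av2 s00 s0N.
have sN := avoids213_image_max_eq0 (avoids_iterates_leq (leqnSn 1) av2) s00 s0N.
pose o1 := cshift N ord0.
have val_o1 : o1 = 1 :> nat by rewrite val_cshift (leq_ltn_trans _ N_gt3).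
have t1 : theta s o1 = 0 :> nat.
  by rewrite -permJ (cshift_conjg_theta s_cycle t0) t0 sN.
have := avoids213_first_max_mem N_gt3 av_theta t0.
rewrite !inE => /orP[] /eqP t_eq; move: t1; rewrite t_eq.
- by rewrite val_swap val_o1 /= ltn_eqF //; lia.
- by rewrite val_preswap ?val_o1 /= ?ltn_eqF //; lia.
Qed.

End Classification.

(** * The orbit of the transposition of 0 and the maximum *)

Section SwapOrbit.

Variable N : nat.
Implicit Types (i j x : 'I_N.+1).

Local Notation swap := (swap N).
Local Notation preswap := (preswap N).
Local Notation cshift := (cshift N).

Definition reversal : 'S_N.+1 := perm (@rev_ord_inj N.+1).

Lemma val_reversal x : reversal x = N - x :> nat.
Proof. by rewrite permE /= subSS. Qed.

Lemma one_cycle_swap : one_cycle swap.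
Proof.
move=> x; case: tpermP => [-> _|-> _|]; rewrite ?eqxx //.
by rewrite -[X in fconnect _ _ X](tpermR ord0 ord_max) fconnect1.
Qed.

Lemma theta_preswap : theta preswap = swap.
Proof. by rewrite theta_cshift_conjg // tpermL. Qed.

Lemma theta_swap : theta swap = cshift.
Proof.
have s_cycle := one_cycle_swap; apply: pos_mono_eq => i j ij.
have cshift_fixed (k : 'I_N.+1) :
    k.+1 < N -> swap (cshift k) = cshift k /\ cshift k != ord_max.
  move=> kN.
  have val_ck : cshift k = k.+1 :> nat by rewrite val_cshift (ltnW kN).
  have ckN : cshift k != ord_max by rewrite -ltn_ord_max val_ck.
  by split=> //; apply: tpermD; rewrite eq_sym // -gtn_ord0 val_ck.
have cshift_max0 (k : 'I_N.+1) : N <= k.+1 -> fconnect swap ord_max (cshift k).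
  move=> Nk; have [->|kN] := eqVneq k ord_max.
    by rewrite cshift_max -(tpermR ord0 ord_max) fconnect1.
  rewrite (_ : cshift k = ord_max) ?connect0 //.
  apply: val_inj; move: kN; rewrite /= -ltn_ord_max val_cshift.
  by case: ifP; lia.
have [iN|Ni] := ltnP i.+1 N.
  have [si ciN] := cshift_fixed i iN; have [jN|Nj] := ltnP j.+1 N.
    have [sj cjN] := cshift_fixed j jN; apply: pos_theta_fixed_mono => //.
    by rewrite !val_cshift (ltnW iN) (ltnW jN) ltnS.
  by apply: pos_theta_fixed_lt_cycle => //; apply: cshift_max0.
have iN : i.+1 = N by have := leq_ord j; lia.
rewrite (_ : cshift i = ord_max); last first.
  by apply: val_inj; rewrite /= val_cshift; case: ifP; lia.
rewrite ltn_neqAle pos_theta_max_le ?cshift_max0 ?pos_neq //; last by lia.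
by rewrite eq_sym -ltn_ord_max val_cshift; case: ifP; lia.
Qed.

Lemma theta_cshift : theta cshift = (cshift^-1)%g.
Proof.
have {1}-> : cshift = (cshift ^ cshift^-1)%g.
  by rewrite conjgE invgK mulgV mulg1.
by rewrite theta_cshift_conjg // -(cshift_max N) permK.
Qed.

Lemma theta_cshiftV : theta (cshift^-1)%g = reversal.
Proof.
have -> : (cshift^-1)%g = (cshift ^ reversal)%g.
  apply/permP => x; rewrite -[x](permKV reversal); move: (_ x) => i.
  rewrite permJ; apply: (@perm_inj _ cshift); rewrite permKV; apply: val_inj.
  rewrite /= val_cshift !val_reversal val_cshift.
  by have := leq_ord i; do ![case: ifP]; lia.
by rewrite theta_cshift_conjg //; apply: val_inj; rewrite /= val_reversal subn0.
Qed.

Lemma not_one_cycle_reversal : 2 < N -> ~ one_cycle reversal.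
Proof.
move=> N_gt2; pose o1 : 'I_N.+1 := inord 1.
have val1 : o1 = 1 :> nat by rewrite inordK //; lia.
have closed_pair :
    fclosed reversal [pred x : 'I_N.+1 | (x == 0 :> nat) || (x == N :> nat)].
  apply: perm_fclosed => x; rewrite !inE val_reversal.
  by have := leq_ord x; lia.
have rev1 : reversal o1 != o1 by rewrite -val_eqE /= val_reversal val1; lia.
move=> /(_ _ rev1)/(closed_connect closed_pair).
by rewrite !inE /= eqxx orbT val1; lia.
Qed.

Lemma avoids213_preswap : 2 < N -> avoids p213 preswap.
Proof.
move=> N_gt2; apply/avoids213P => i j k; rewrite !val_preswap //.
by have := leq_ord k; do ![case: ifP]; lia.
Qed.

Lemma avoids213_swap : avoids p213 swap.
Proof.
apply/avoids213P => i j k; rewrite !val_swap.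
by have := leq_ord k; do ![case: ifP]; lia.
Qed.

Lemma avoids213_cshift : avoids p213 cshift.
Proof.
apply/avoids213P => i j k; rewrite !val_cshift.
by have := leq_ord k; do ![case: ifP]; lia.
Qed.

Lemma avoids213_cshiftV : avoids p213 (cshift^-1)%g.
Proof.
apply/avoids213_posP => x y z; rewrite /pos invgK !val_cshift.
move: (leq_ord x) (leq_ord y) (leq_ord z).
by do ![case: ifP]; lia.
Qed.

Lemma avoids213_reversal : avoids p213 reversal.
Proof. by apply/avoids213P => i j k; rewrite !val_reversal; lia. Qed.

Lemma avoids213_iterates_swap k :
  2 < N -> avoids_iterates p213 k swap = (k <= 3).
Proof.
move=> N_gt2.
have theta4 : avoids p213 (theta reversal) = false.
  apply: contra_notF (not_one_cycle_reversal N_gt2).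
  exact: avoids213_theta_one_cycle.
rewrite /avoids_iterates; case: k => [|[|[|[|k]]]] /=;
  rewrite avoids213_swap ?theta_swap ?avoids213_cshift ?theta_cshift
    ?avoids213_cshiftV ?theta_cshiftV ?avoids213_reversal ?theta4 //.
Qed.

Lemma avoids213_iterates_preswap k :
  2 < N -> avoids_iterates p213 k preswap = (k <= 4).
Proof.
case: k => [|k] N_gt2; first by rewrite /avoids_iterates /= avoids213_preswap.
rewrite -[RHS](avoids213_iterates_swap k N_gt2) -theta_preswap.
by rewrite /avoids_iterates /= avoids213_preswap.
Qed.

Lemma preswap_neq_swap : 2 < N -> preswap != swap.
Proof.
move=> N_gt2; apply: contraTneq (avoids213_iterates_preswap 4 N_gt2) => ->.
by rewrite avoids213_iterates_swap.
Qed.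

End SwapOrbit.

(** * Counting *)

Section Lift.

Variable n : nat.
Implicit Types s t : 'S_n.

Local Notation lift0_perm := (lift_perm ord0 ord0).

Lemma one_line_lift s :
  one_line (lift0_perm s) = ord0 :: map (lift ord0) (one_line s).
Proof.
rewrite /one_line enum_ordSl /= lift_perm_id -!map_comp.
by congr cons; apply: eq_map => i /=; rewrite lift_perm_lift.
Qed.

Lemma orbit_lift s i :
  fingraph.orbit (lift0_perm s) (lift ord0 i)
  = map (lift ord0) (fingraph.orbit s i).
Proof.
by apply/esym/map_orbit => [|j]; [apply: lift_inj | rewrite lift_perm_lift].
Qed.

Lemma cycle_maxima_lift s :
  cycle_maxima (lift0_perm s) = ord0 :: map (lift ord0) (cycle_maxima s).
Proof.
rewrite /cycle_maxima enum_ordSl /= orbit_fixed ?lift_perm_id //= filter_map.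
congr (_ :: map _ _); apply: eq_filter => i /=.
by rewrite orbit_lift all_map; apply: eq_all => j; apply: leq_bump2.
Qed.

Lemma theta_lift s : theta (lift0_perm s) = lift0_perm (theta s).
Proof.
apply: one_line_inj; rewrite one_line_lift !one_line_theta.
rewrite /theta_word /std_cycles cycle_maxima_lift /=.
rewrite orbit_fixed ?lift_perm_id //= map_flatten -!map_comp.
by congr (_ :: flatten _); apply: eq_map => i /=; rewrite orbit_lift.
Qed.

Lemma avoids213_lift s : avoids p213 (lift0_perm s) = avoids p213 s.
Proof.
apply/avoids213P/avoids213P => av i j k.
  move=> ij jk; have := av (lift ord0 i) (lift ord0 j) (lift ord0 k).
  by rewrite !lift_perm_lift !lift0 !ltnS; apply.
case: (unliftP ord0 i) => [i' ->|->]; last by rewrite lift_perm_id ltn0.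
case: (unliftP ord0 j) => [j' ->|-> //].
case: (unliftP ord0 k) => [k' ->|-> //].
by rewrite !lift_perm_lift !lift0 !ltnS; apply: av.
Qed.

Lemma avoids213_iterates_lift k s :
  avoids_iterates p213 k (lift0_perm s) = avoids_iterates p213 k s.
Proof.
rewrite /avoids_iterates -(@map_traject _ _ (@theta n)) => [|t].
  by rewrite all_map; apply: eq_all => t; apply: avoids213_lift.
by rewrite theta_lift.
Qed.

Lemma lift0_perm_inj : injective (lift0_perm : 'S_n -> 'S_n.+1).
Proof.
move=> s t /permP st; apply/permP => i; apply: (@lift_inj _ ord0).
by rewrite -!(lift_perm_lift ord0 ord0) st.
Qed.

Lemma lift0_permP (t : 'S_n.+1) : t ord0 = ord0 -> exists s, t = lift0_perm s.
Proof.
move=> t0; have t_lift i : {j | t (lift ord0 i) = lift ord0 j}.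
  case: (unliftP ord0 (t (lift ord0 i))) => [j ->|ti0]; first by exists j.
  by move: ti0; rewrite -[RHS]t0 => /perm_inj.
have s_inj : injective (fun i => sval (t_lift i)).
  move=> i j; case: (t_lift i) (t_lift j) => [a ta] [b tb] /= ab.
  by apply: (@lift_inj _ ord0); apply: (@perm_inj _ t); rewrite ta tb ab.
exists (perm s_inj); apply/permP => i.
case: (unliftP ord0 i) => [j ->|->]; last by rewrite lift_perm_id.
by rewrite lift_perm_lift permE; case: (t_lift j).
Qed.

Lemma t_count213S k : t_count p213 k n.+1 = t_count p213 k n +
  #|[set s : 'S_n.+1 | avoids_iterates p213 k s & s ord0 != ord0]|.
Proof.
rewrite !t_countE -(cardsID [set s : 'S_n.+1 | s ord0 == ord0]); congr (_ + _).
  rewrite -(card_imset _ lift0_perm_inj); apply: eq_card => t.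
  rewrite !inE; apply/andP/imsetP => [[t_k /eqP /lift0_permP[s ts]]|[s]].
    by exists s => //; rewrite inE -avoids213_iterates_lift -ts.
  by rewrite inE => s_k ->; rewrite avoids213_iterates_lift lift_perm_id.
by apply: eq_card => t; rewrite !inE andbC.
Qed.

End Lift.

Lemma card_avoids213_iterates_moving0 (N k : nat) : 3 < N -> 3 <= k ->
  #|[set s : 'S_N.+1 | avoids_iterates p213 k s & s ord0 != ord0]|
  = (k <= 3) + (k <= 4).
Proof.
move=> N_gt3 k_ge3; have N_gt2 := ltnW N_gt3; pose r := [:: swap N; preswap N].
have r_uniq : uniq r by rewrite /= inE eq_sym preswap_neq_swap.
have moving0 (s : 'S_N.+1) : s \in r -> s ord0 != ord0.
  rewrite !inE -gtn_ord0 => /orP[] /eqP ->; first by rewrite val_swap /=; lia.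
  by rewrite val_preswap //=; lia.
rewrite (eq_card (B := mem [seq s <- r | avoids_iterates p213 k s])) => [|s].
  rewrite (card_uniqP (filter_uniq _ r_uniq)) size_filter /=.
  by rewrite addn0 avoids213_iterates_swap // avoids213_iterates_preswap.
rewrite !inE mem_filter; apply: andb_id2l => s_k.
apply/idP/idP; last exact: moving0.
by apply: avoids213_moving0_mem => //; apply: avoids_iterates_leq s_k.
Qed.

(** * Evaluation on words *)

(* Elements of 'S_n do not evaluate under vm_compute, so t_count is expressed
   through operations on lists of natural numbers. *)

Definition subseqs (T : Type) (w : seq T) : seq (seq T) :=
  foldr (fun x r => [seq x :: u | u <- r] ++ r) [:: [::]] w.

Lemma mem_subseqs (T : eqType) (u w : seq T) : (u \in subseqs w) = subseq u w.
Proof.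
elim: w u => [|x w IHw] [|y u] //=.
  by rewrite mem_cat IHw sub0seq orbT.
have mem_map_cons :
    (y :: u \in map (cons x) (subseqs w)) = (y == x) && subseq u w.
  rewrite -IHw; apply/mapP/andP => [[v v_in [-> ->]] //|[/eqP-> u_in]].
  by exists u.
rewrite mem_cat IHw mem_map_cons; case: eqP => //= _.
exact/orb_idr/cons_subseq.
Qed.

Definition word_contains (tau w : seq nat) : bool :=
  has (fun u => order_iso u tau) (subseqs w).

Definition word_cycle (w : seq nat) (m : nat) : seq nat :=
  traject (nth 0 w) m (size (undup (traject (nth 0 w) m (size w)))).

Definition word_theta (w : seq nat) : seq nat :=
  flatten [seq word_cycle w m |
             m <- iota 0 (size w) & all (geq m) (word_cycle w m)].

Definition word_avoids_iterates (tau : seq nat) (k : nat) (w : seq nat) :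
    bool :=
  all (fun v => ~~ word_contains tau v) (traject word_theta w k.+1).

Section Word.

Variable n : nat.
Implicit Types (s : 'S_n) (i m : 'I_n).

Definition word s : seq nat := [seq nat_of_ord x | x <- one_line s].

Lemma size_word s : size (word s) = n.
Proof. by rewrite 2!size_map size_enum_ord. Qed.

Lemma nth_word s i : nth 0 (word s) i = s i.
Proof.
by rewrite /word -map_comp (nth_map i) ?size_enum_ord // nth_ord_enum.
Qed.

Lemma word_inj : injective word.
Proof. by move=> s t /(inj_map val_inj)/one_line_inj. Qed.

Lemma word_containsE tau s : word_contains tau (word s) = contains tau s.
Proof.
apply/hasP/containsP => [[u]|[r sub iso]].
  rewrite mem_subseqs => /subseqP[m _ ->] iso.
  by exists (mask m (one_line s)); rewrite ?mask_subseq // map_mask.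
by exists (map (@nat_of_ord n) r); rewrite // mem_subseqs map_subseq.
Qed.

Lemma word_cycleE s m : word_cycle (word s) m = map val (fingraph.orbit s m).
Proof.
have trajectE k : traject (nth 0 (word s)) m k = map val (traject s m k).
  by rewrite (map_traject (g := nth 0 (word s))) // => i; rewrite nth_word.
rewrite /word_cycle size_word !trajectE undup_map_inj; last exact: val_inj.
by rewrite size_map -order_size_undup // card_ord.
Qed.

Lemma word_thetaE s : word_theta (word s) = word (theta s).
Proof.
rewrite /word one_line_theta /theta_word /std_cycles /cycle_maxima.
rewrite -/(word s) /word_theta size_word -val_enum_ord filter_map map_flatten.
rewrite -!map_comp (eq_map (word_cycleE s)); congr (flatten (map _ _)).
apply: eq_filter => m /=.
by rewrite word_cycleE all_map.
Qed.

Lemma word_avoids_iteratesE tau k s :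
  word_avoids_iterates tau k (word s) = avoids_iterates tau k s.
Proof.
rewrite /word_avoids_iterates -(@map_traject _ _ (@theta n)) => [|t].
  by rewrite all_map; apply: eq_all => t; rewrite /= word_containsE.
by rewrite word_thetaE.
Qed.

Lemma perm_words : perm_eq (map word (enum 'S_n)) (permutations (iota 0 n)).
Proof.
have words_uniq : uniq (map word (enum 'S_n)).
  by rewrite map_inj_uniq ?enum_uniq //; apply: word_inj.
have words_sub : {subset map word (enum 'S_n) <= permutations (iota 0 n)}.
  move=> _ /mapP[s _ ->]; rewrite mem_permutations -val_enum_ord.
  apply/perm_map/uniq_perm => [||i]; rewrite ?enum_uniq //.
    by rewrite map_inj_uniq ?enum_uniq //; apply: perm_inj.
  by rewrite -[i](permKV s) (mem_map (@perm_inj _ s)) !mem_enum.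
apply: uniq_perm => //; first exact: permutations_uniq.
apply: (uniq_min_size words_uniq words_sub _).2.
by rewrite size_permutations ?iota_uniq // size_iota size_map -cardE card_Sn.
Qed.

Lemma t_count_word tau k :
  t_count tau k n
  = count (word_avoids_iterates tau k) (permutations (iota 0 n)).
Proof.
rewrite t_countE -(seq.permP perm_words) count_map.
rewrite cardsE cardE enumT size_filter.
by apply: eq_count => s; rewrite /= word_avoids_iteratesE.
Qed.

End Word.

Lemma avoids213_iterates5_stable (s : 'S_4) :
  avoids_iterates p213 5 s -> avoids_iterates p213 6 s.
Proof.
have /allP stable : all (fun w => word_avoids_iterates p213 5 w ==>
    word_avoids_iterates p213 6 w) (permutations (iota 0 4)) by vm_compute.
rewrite -!word_avoids_iteratesE; apply/implyP/stable.
by rewrite -(perm_mem (perm_words 4)) map_f ?mem_enum.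
Qed.

Lemma t_count213_4 (k : nat) :
  3 <= k -> t_count p213 k 4 = 7 + ((k <= 3) + (k <= 4)).
Proof.
move=> k_ge3; case: (ltngtP k 4) => [k_lt4|k_gt4|->].
- have -> : k = 3 by apply/eqP; rewrite eqn_leq k_ge3 -ltnS k_lt4.
  by rewrite t_count_word; vm_compute.
- rewrite t_countE (eq_card (B := [set s : 'S_4 | avoids_iterates p213 5 s])).
    by rewrite -t_countE t_count_word leqNgt ltnW //; vm_compute.
  move=> s.
  by rewrite !inE (avoids_iterates_stable _ avoids213_iterates5_stable).
- by rewrite t_count_word; vm_compute.
Qed.

Lemma t_count213E (n k : nat) : 4 <= n -> 3 <= k ->
  t_count p213 k n = 7 + (n - 3) * ((k <= 3) + (k <= 4)).
Proof.
move=> n_ge4 k_ge3; rewrite -(subnKC n_ge4); elim: (n - 4) => [|d IHd].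
  by rewrite t_count213_4 // mul1n.
rewrite addnS t_count213S IHd card_avoids213_iterates_moving0 //.
by rewrite subSn // mulSn; lia.
Qed.

Theorem theorem4p2 (n : nat) (hn : 5 <= n) :
  [/\ t_count [:: 2; 1; 3] 3 n = 2 * n + 1,
      t_count [:: 2; 1; 3] 4 n = n + 4
    & forall k : nat, 5 <= k -> t_count [:: 2; 1; 3] k n = 7].
Proof.
by split=> [||k k_ge5]; rewrite t_count213E //=; lia.
Qed.
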